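(* Let $m,n\ge1$, let $\{a_j^{(i)}\}_{1\le i\le n,1\le j\le m}$ be complex numbers no two of which differ by an integer, let $M>0$ be an integer, and let $A_0\in\operatorname{Mat}(m,\mathbb{C})$ have spectrum $\{\rho_1,\dots,\rho_m\}$ with $\rho_i\ne0$ for all $i$ and $\rho_i/\rho_j\notin\mathbb{R}$ for $i\neq j$. For generic $B_1,\dots,B_n\in\operatorname{Mat}(m,\mathbb{C})$ with $Sp(B_i)=\{a_j^{(i)}\}_{j=1}^m$, let $\{B_i(k):\max_l|k_l|\le M\}$ be the unique solution of the difference Schlesinger equations with $B_i(0,\dots,0)=B_i$ and $Sp(B_i(k_1,\dots,k_n))=Sp(B_i)-k_i$, and set $$C_i(l_1,\dots,l_n):=B_i(l_1,\dots,l_i,l_{i+1}+1,\dots,l_n+1),\qquad i=1,\dots,n.$$ Then $\{C_i(l)\}$ satisfy, for every $i=1,\dots,n$, the equations (identities of polynomials in $z$) $$(z+1-C_i)\cdots(z+1-C_n)\,A_0\,(z-C_1)\cdots(z-C_{i-1})=(z+1-\widetilde C_{i+1})\cdots(z+1-\widetilde C_n)\,A_0\,(z-\widetilde C_1)\cdots(z-\widetilde C_i),$$ where $C_j=C_j(l_1,\dots,l_n)$, $\widetilde C_j=C_j(l_1,\dots,l_{i-1},l_i+1,l_{i+1},\dots,l_n)$ for all $j$, and $$C_i(l_1+1,\dots,l_n+1)=A_0^{-1}C_i(l_1,\dots,l_n)A_0-I.$$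
   Context: $Sp$ denotes spectrum; $Sp(B)-k$ is the spectrum shifted by $-k$; scalars such as $z$ stand for scalar matrices. ''Generic'' means belonging to a (nonempty) Zariski open subset of the variety of $n$-tuples $(B_1,\dots,B_n)$ with the prescribed spectra. The difference Schlesinger equations are, with $e_i$ the standard basis of $\mathbb{Z}^n$ and $i,j=1,\dots,n$: $$B_i(k)-B_i(k+e_j)=B_j(k)-B_j(k+e_i),\qquad B_j(k+e_i)B_i(k)=B_i(k+e_j)B_j(k),$$ $$B_i(k_1+1,\dots,k_n+1)=A_0^{-1}B_i(k_1,\dots,k_n)A_0-I.$$ For generic initial conditions $\{B_i\}$ there is a unique solution in the range $\max_l|k_l|\le M$ with the stated initial and spectral conditions. All equations are understood for those multi-indices for which every matrix involved is defined (lies in this range). Empty products are $1$: for $i=1$ the product $(z-C_1)\cdots(z-C_{i-1})$ is empty, and for $i=n$ the product $(z+1-\widetilde C_{i+1})\cdots(z+1-\widetilde C_n)$ is empty. *)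

(* Defs.v *)
From HB Require Import structures.
From mathcomp Require Import all_boot all_order all_algebra.
From mathcomp Require Import boolp classical_sets reals.
From mathcomp Require Import complex.
From mathcomp Require mpoly.

Set Implicit Arguments.
Unset Strict Implicit.
Unset Printing Implicit Defensive.

Import Order.TTheory GRing.Theory Num.Theory.

Local Open Scope classical_set_scope.
Local Open Scope ring_scope.

(* A set, without multiplicities: every spectrum prescribed below consists of
   m distinct numbers, so nothing is lost with respect to a multiset. *)
Definition spectrum (F : fieldType) (m : nat) (A : 'M[F]_m) : set F :=
  [set x | eigenvalue A x].

Section Zariski.
Variables (F : fieldType) (n m : nat).

(* The n * m * m entries of a tuple of matrices, as a point of affine space. *)
Definition entries (B : 'I_n -> 'M[F]_m) :
    'I_#|{: 'I_n * 'I_m * 'I_m}| -> F :=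
  fun s => let: (i, r, c) := enum_val s in B i r c.

Definition zariski_open_in (V U : set ('I_n -> 'M[F]_m)) : Prop :=
  exists S : set (mpoly.mpoly #|{: 'I_n * 'I_m * 'I_m}| F),
    U = [set B | V B /\ exists2 p, S p & mpoly.meval (entries B) p != 0].

Definition generic_in (V P : set ('I_n -> 'M[F]_m)) : Prop :=
  exists U, [/\ zariski_open_in V U, U !=set0 & U `<=` P].

Definition prescribed_spectra (a : 'I_n -> 'I_m -> F) :
    set ('I_n -> 'M[F]_m) :=
  [set B | forall i, spectrum (B i) = range (a i)].

End Zariski.

Section Schlesinger.
Variables (F : fieldType) (n m M : nat).

(* Multi-indices in Z^n are integer row vectors. *)
Definition unitv (j : 'I_n) : 'rV[int]_n := delta_mx 0 j.
Definition ones : 'rV[int]_n := const_mx 1.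

Definition in_range (k : 'rV[int]_n) : Prop :=
  forall j, `|k 0 j| <= M%:Z.

(* Families are total functions of the multi-index; only their values inside
   the range are ever constrained or used. *)
Definition matrix_family := 'I_n -> 'rV[int]_n -> 'M[F]_m.

Record difference_schlesinger (A0 : 'M[F]_m) (B : matrix_family) : Prop := {
  schlesinger_add : forall i j k,
    in_range k -> in_range (k + unitv i) -> in_range (k + unitv j) ->
    B i k - B i (k + unitv j) = B j k - B j (k + unitv i);
  schlesinger_mul : forall i j k,
    in_range k -> in_range (k + unitv i) -> in_range (k + unitv j) ->
    B j (k + unitv i) *m B i k = B i (k + unitv j) *m B j k;
  schlesinger_shift : forall i k,
    in_range k -> in_range (k + ones) ->
    B i (k + ones) = invmx A0 *m B i k *m A0 - 1%:M }.

(* Uniqueness is not part of this predicate: imposing the equations only inside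
   the range leaves some corner values, such as B_1(M, -M) for n = 2,
   constrained by their spectrum alone. *)
Record schlesinger_solution (A0 : 'M[F]_m) (B0 : 'I_n -> 'M[F]_m)
    (B : matrix_family) : Prop := {
  solution_equations : difference_schlesinger A0 B;
  solution_initial : forall i, B i 0 = B0 i;
  solution_spectra : forall i k, in_range k ->
    spectrum (B i k) = [set x - (k 0 i)%:~R | x in spectrum (B0 i)] }.

(* (l_1, ..., l_i, l_(i+1) + 1, ..., l_n + 1) *)
Definition shift_after (i : 'I_n) (l : 'rV[int]_n) : 'rV[int]_n :=
  \row_j (if (i < j)%N then l 0 j + 1 else l 0 j).

Definition Cfam (B : matrix_family) : matrix_family :=
  fun i l => B i (shift_after i l).

Definition Cdefined (i : 'I_n) (l : 'rV[int]_n) : Prop :=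
  in_range (shift_after i l).

(* Matrix polynomials in z are matrices over F[z], with z = 'X; \prod is taken
   in increasing order of the index, from left to right. *)
Definition mxC (A : 'M[F]_m) : 'M[{poly F}]_m := map_mx polyC A.

Definition C_exchange (A0 : 'M[F]_m) (C : matrix_family) (i : 'I_n)
    (l : 'rV[int]_n) : Prop :=
  (\prod_(j < n | (i <= j)%N) (('X + 1)%:M - mxC (C j l)))
    *m mxC A0 *m
  (\prod_(j < n | (j < i)%N) ('X%:M - mxC (C j l)))
  =
  (\prod_(j < n | (i < j)%N) (('X + 1)%:M - mxC (C j (l + unitv i))))
    *m mxC A0 *m
  (\prod_(j < n | (j <= i)%N) ('X%:M - mxC (C j (l + unitv i)))).

End Schlesinger.

(* Main.v *)
Require Import Defs.
From HB Require Import structures.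
From mathcomp Require Import all_boot all_order all_algebra.
From mathcomp Require Import boolp classical_sets reals.
From mathcomp Require Import complex zify.
From mathcomp Require mpoly.

Set Implicit Arguments.
Unset Strict Implicit.
Unset Printing Implicit Defensive.

Import Order.TTheory GRing.Theory Num.Theory.

Local Open Scope classical_set_scope.
Local Open Scope ring_scope.

(** The equations z - B_i form a flat discrete connection on the lattice: attach
    to the edge from k to k + e_i the factor z - B_i(k).  The additive and
    multiplicative Schlesinger equations say together that the two ways round
    a unit square have the same product ([factor_exchange]), and the shift
    equation says that A0 intertwines the edge factor at k + (1, ..., 1) and
    parameter z with the one at k and parameter z + 1 ([factor_conj_shift]).

    Since C_j(l) = B_j at the corner l + e_(j+1) + ... + e_n, the matrices
    C_n(l), ..., C_1(l) sit on the edges of the staircase that climbs from l to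
    l + (1, ..., 1) along e_n, ..., e_1.  Both sides of the exchange relation
    are then the transport along a closed staircase: start at the corner
    s = l + e_i + ... + e_n, climb to the top, return to the bottom by A0, and
    climb again.  The right side begins with a step e_i and then follows the
    staircase translated by e_i; the left side follows the staircase of l and
    ends with the step e_i.  They agree because the factor in direction i can
    be carried through every other factor ([prod_intertwine]), through the
    steps i-1, ..., 1, then through A0, then through the steps n, ..., i+1.

    The one delicate square is that of step 1, whose far corner l + (1, ..., 1)
    may leave the range.  The value there is replaced by the one that the shift
    equation would give, and when l_1 = M the square is the image under
    the shift of a square based at l - e_1, which lies inside the range
    ([outer_corner_exchange]).

    The argument holds for every solution, so that the Zariski open set can be
    the whole variety of tuples with the prescribed spectra; it contains tuples
    of diagonal matrices. *)

(** * Exchange of linear factors in a ring *)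

Section Exchange.
Variable R : pzRingType.

(** The equality (z - u)(z - v) = (z - w)(z - x), read off coefficientwise in a
    central variable z. *)
Definition exchange (u v w x : R) : Prop := u + v = w + x /\ u * v = w * x.

Lemma exchange_factors (c u v w x : R) :
  (forall y, c * y = y * c) -> exchange u v w x ->
  (c - u) * (c - v) = (c - w) * (c - x).
Proof.
move=> cC [sum_eq prod_eq].
have expand a b : (c - a) * (c - b) = c * c - c * (a + b) + a * b.
  rewrite mulrBl !mulrBr -(cC a) mulrDr opprB opprD !addrA.
  by rewrite addrAC (addrAC (c * c)).
by rewrite !expand sum_eq prod_eq.
Qed.

(** The shift by (1, ..., 1) acts on a solution through such a map y |-> phi y,
    additive and, as s t = 1, multiplicative up to the translation by -1. *)
Lemma exchange_conj (s t u v w x : R) : s * t = 1 ->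
  let phi y := t * y * s - 1 in
  exchange u v w x -> exchange (phi u) (phi v) (phi w) (phi x).
Proof.
move=> st1 phi [sum_eq prod_eq].
have phiD a b : phi a + phi b = t * (a + b) * s - 1 - 1.
  by rewrite /phi mulrDr mulrDl addrACA !addrA.
have phiM a b : phi a * phi b = t * (a * b) * s - t * (a + b) * s + 1.
  rewrite /phi mulrBl mulrBr mulr1 mul1r -!mulrA (mulrA s t) st1 mul1r.
  by rewrite opprB mulrDl mulrDr opprD !addrA addrAC.
by split; rewrite ?phiD ?phiM sum_eq ?prod_eq.
Qed.

(** The x j form a ladder between the two products: each of them is carried
    past one factor, which turns g j into f j, and the products telescope.
    Ranges of indices that depend on i are encoded by factors equal to 1, which
    also allows x to become 1, that is to be absorbed into the products. *)
Lemma prod_intertwine (n : nat) (f g : 'I_n -> R) (x : nat -> R) :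
  (forall j : 'I_n, g j * x j.+1 = x j * f j) ->
  (\prod_(j < n) g j) * x n = x 0%N * \prod_(j < n) f j.
Proof.
elim: n f g => [|n IHn] f g gf; first by rewrite !big_ord0 mul1r mulr1.
rewrite !big_ord_recr /= -mulrA (gf ord_max) /= !mulrA; congr (_ * _).
by apply: IHn => j; apply: (gf (widen_ord (leqnSn n) j)).
Qed.

End Exchange.

(** * The staircase of corners *)

Section Staircase.
Variables (n M : nat).
Implicit Types l : 'rV[int]_n.

(** Indices of the coordinates start at 0: corner j is
    l + e_j + ... + e_(n-1), from l + (1, ..., 1) for j = 0 down to l for j = n,
    and C_j(l) is B_j at corner j + 1. *)
Definition stair l (j : nat) : 'rV[int]_n :=
  \row_k (if (j <= k)%N then l 0 k + 1 else l 0 k).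

Lemma stair0 l : stair l 0 = l + ones n.
Proof. by apply/rowP => k; rewrite !mxE. Qed.

Lemma stair_last l : stair l n = l.
Proof. by apply/rowP => k; rewrite mxE leqNgt ltn_ord. Qed.

Lemma stair_step l (j : 'I_n) : stair l j = stair l j.+1 + unitv j.
Proof.
apply/rowP => k; rewrite !mxE /=.
have [<-|jk] := eqVneq j k; first by rewrite leqnn ltnn.
by rewrite addr0 [(j <= k)%N]leq_eqVlt
  (negPf (jk : j != k :> nat)).
Qed.

Lemma shift_after_stair (j i : 'I_n) l :
  shift_after j (l + unitv i) = stair l j.+1 + unitv i.
Proof.
by apply/rowP => k; rewrite !mxE /=; case: ifP => _ //; rewrite addrAC.
Qed.

Lemma shift_after_ones (j : 'I_n) l :
  shift_after j (l + ones n) = shift_after j l + ones n.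
Proof. by apply/rowP => k; rewrite !mxE /=; case: ifP. Qed.

Lemma in_rangeP (k : 'rV[int]_n) :
  in_range M k <-> forall j, (- M%:Z <= k 0 j) /\ (k 0 j <= M%:Z).
Proof.
split=> kM j; move: (kM j); rewrite ler_norml; first by move=> /andP.
by move=> [-> ->].
Qed.

End Staircase.

(** * Transport along the staircase *)

Section Factors.
Variables (F : fieldType) (n m M : nat).
Variables (A0 : 'M[F]_m) (B : matrix_family F n m).
Hypothesis M_gt0 : (0 < M)%N.
Hypothesis A0_unit : A0 \in unitmx.
Hypothesis BP : difference_schlesinger M A0 B.

Definition conj_shift (Y : 'M[F]_m) : 'M[F]_m := invmx A0 *m Y *m A0 - 1%:M.

Lemma schlesinger_exchange i j k :
  in_range M k -> in_range M (k + unitv i) -> in_range M (k + unitv j) ->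
  exchange (B j (k + unitv i)) (B i k) (B i (k + unitv j)) (B j k).
Proof.
move=> k_in ki_in kj_in; split; last first.
  by rewrite -!mulmxE (schlesinger_mul BP).
have /eqP := schlesinger_add BP k_in ki_in kj_in.
by rewrite subr_eq => /eqP ->; rewrite addrA subrKC addrC.
Qed.

(** The value at the outer corner l + (1, ..., 1), which may lie outside the
    range, is the one prescribed by the shift equation. *)
Definition corner_value (i : 'I_n) (l : 'rV[int]_n) (j : nat) : 'M[F]_m :=
  if j is 0%N then conj_shift (B i l) else B i (stair l j).

Variables (i : 'I_n) (l : 'rV[int]_n).
Hypothesis l_in : forall j : 'I_n,
  in_range M (stair l j.+1) /\ in_range M (stair l j.+1 + unitv i).

Lemma stair_in j : (0 < j <= n)%N -> in_range M (stair l j).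
Proof. by case: j => // j jn; case: (l_in (Ordinal jn)). Qed.

Lemma base_in : in_range M l.
Proof. by rewrite -(stair_last l); apply: stair_in; have := ltn_ord i; lia. Qed.

Lemma corner_value_step : B i (stair l i.+1 + unitv i) = corner_value i l i.
Proof.
rewrite -stair_step; have [_] := l_in i; rewrite -stair_step.
case: (nat_of_ord i) => [|//]; rewrite stair0 => l1_in.
exact: (schlesinger_shift BP i base_in l1_in).
Qed.

(** If l + (1, ..., 1) is in the range, this is an ordinary square.  Otherwise
    l_0 = M; then the square based at q = l - e_0 is entirely in the range
    because -M < M, and the shift maps it to the one considered. *)
Lemma outer_corner_exchange (j : 'I_n) : j = 0%N :> nat -> j != i ->
  exchange (B j (stair l 1 + unitv i)) (B i (stair l 1))
    (conj_shift (B i l)) (B j (stair l 1)).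
Proof.
move=> j0 ji; have [p_in pi_in] := l_in j; rewrite j0 in p_in pi_in.
have lE : l + ones n = stair l 1 + unitv j.
  by have := stair_step l j; rewrite j0 stair0.
have [l1_in | l1_out] := leP (l 0 j + 1) M%:Z.
  have l1_in' : in_range M (l + ones n).
    apply/in_rangeP => k; move/in_rangeP: p_in => /(_ k).
    move/in_rangeP: base_in => /(_ j).
    rewrite !mxE; have [->|] := eqVneq k j; first by rewrite j0 /=; lia.
    by rewrite -val_eqE /= j0 -lt0n => ->; lia.
  rewrite /conj_shift -(schlesinger_shift BP i base_in l1_in') lE.
  by apply: schlesinger_exchange => //; rewrite -lE.
pose q := l - unitv j.
have qj : q + unitv j = l by rewrite subrK.
have qE : q + ones n = stair l 1 by rewrite /q addrAC lE addrK.
have qiE : q + unitv i + ones n = stair l 1 + unitv i by rewrite addrAC qE.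
have l_bounds k : - M%:Z <= l 0 k /\ l 0 k + (k != j)%:R <= M%:Z.
  move/in_rangeP: base_in => /(_ k); move/in_rangeP: p_in => /(_ k).
  rewrite !mxE; have [->|] := eqVneq k j; first by rewrite j0 /= addr0; lia.
  by rewrite -val_eqE /= j0 -lt0n => -> /=; lia.
have q_in : in_range M q.
  apply/in_rangeP => k; have := l_bounds k; rewrite !mxE /=.
  by have [->|] := eqVneq k j; rewrite /=; lia.
have qi_in : in_range M (q + unitv i).
  apply/in_rangeP => k; have := l_bounds k; rewrite !mxE /=.
  have [->|kj] := eqVneq k j; first by rewrite (negPf ji) /=; lia.
  by case: (k == i) => /=; lia.
have shift_j1 := schlesinger_shift BP j q_in; rewrite qE in shift_j1.
have shift_i1 := schlesinger_shift BP i q_in; rewrite qE in shift_i1.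
have shift_j2 := schlesinger_shift BP j qi_in; rewrite qiE in shift_j2.
rewrite shift_j1 // shift_i1 // shift_j2 // -qj.
apply: (@exchange_conj _ A0 (invmx A0)); first by rewrite -mulmxE mulmxV.
by apply: schlesinger_exchange; rewrite ?qj //; apply: base_in.
Qed.

Lemma stair_exchange (j : 'I_n) : j != i ->
  exchange (B j (stair l j.+1 + unitv i)) (B i (stair l j.+1))
    (corner_value i l j) (B j (stair l j.+1)).
Proof.
move=> ji; have [j0|j_gt0] := posnP j.
  by rewrite j0 /=; apply: outer_corner_exchange.
have -> : corner_value i l j = B i (stair l j.+1 + unitv j).
  by rewrite -stair_step /corner_value; case: (nat_of_ord j) j_gt0.
have [p_in pi_in] := l_in j; apply: schlesinger_exchange => //.
by rewrite -stair_step; apply: stair_in; have := ltn_ord j; lia.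
Qed.

Local Notation factor c A := (c%:M - mxC A).

Lemma factor_exchange (c : {poly F}) (u v w x : 'M[F]_m) :
  exchange u v w x -> factor c u * factor c v = factor c w * factor c x.
Proof.
move=> [sum_eq prod_eq]; apply: exchange_factors.
  by move=> y; rewrite -mulmxE scalar_mxC.
by split; rewrite /mxC -?map_mxD ?sum_eq // -!mulmxE -!map_mxM !mulmxE prod_eq.
Qed.

Lemma factor_conj_shift (Y : 'M[F]_m) :
  mxC A0 * factor 'X (conj_shift Y) = factor ('X + 1) Y * mxC A0.
Proof.
have A0K : mxC A0 * mxC (invmx A0) = 1.
  by rewrite -mulmxE -map_mxM mulmxV // map_scalar_mx.
have -> : mxC (conj_shift Y) = mxC (invmx A0) * mxC Y * mxC A0 - 1.
  by rewrite /conj_shift /mxC map_mxB !map_mxM map_scalar_mx.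
rewrite mulrBr mulrBr mulr1 !mulrA A0K mul1r mulrBl.
have -> : ('X + 1)%:M = 'X%:M + 1 :> 'M[{poly F}]_m by rewrite raddfD.
rewrite [in RHS]mulrDl mul1r.
have -> : mxC A0 * 'X%:M = 'X%:M * mxC A0 by rewrite -!mulmxE scalar_mxC.
by rewrite opprB addrA addrAC.
Qed.

(** In [past_lower] the ladder in direction i starts at the outer corner and is
    absorbed at step i, where it coincides with C_i(l + e_i); in [past_upper] it
    is created at step i as z + 1 - C_i(l) and ends at the corner l.  In
    between, A0 turns the value at the outer corner with parameter z into the
    value at l with parameter z + 1. *)
Lemma stair_C_exchange : C_exchange A0 (Cfam B) i l.
Proof.
have past_lower := @prod_intertwine _ n
  (fun j => if (j < i)%N then factor 'X (B j (stair l j.+1)) else 1)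
  (fun j => if (j <= i)%N then factor 'X (B j (stair l j.+1 + unitv i)) else 1)
  (fun j => if (j <= i)%N then factor 'X (corner_value i l j) else 1).
rewrite /= [(n <= i)%N]leqNgt ltn_ord /= mulr1 -!big_mkcond /= in past_lower.
have past_upper := @prod_intertwine _ n
  (fun j => if (i <= j)%N then factor ('X + 1) (B j (stair l j.+1)) else 1)
  (fun j => if (i < j)%N then factor ('X + 1) (B j (stair l j.+1 + unitv i))
            else 1)
  (fun j => if (i < j)%N then factor ('X + 1) (B i (stair l j)) else 1).
rewrite /= ltn_ord mul1r stair_last -!big_mkcond /= in past_upper.
rewrite /C_exchange /Cfam !mulmxE.
under [X in _ = X * _ * _]eq_bigr => j _ do rewrite shift_after_stair.
under [X in _ = _ * X]eq_bigr => j _ do rewrite shift_after_stair.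
rewrite past_lower; last first.
  move=> j; case: (ltngtP j i) => [ji|ji|/val_inj ->].
  - apply/factor_exchange/stair_exchange.
    by rewrite neq_ltn ji.
  - by rewrite mulr1.
  - by rewrite corner_value_step !mulr1.
rewrite [in RHS]mulrA -[X in _ = X * _]mulrA factor_conj_shift [in RHS]mulrA.
rewrite past_upper //.
move=> j; rewrite ltnS; case: (ltngtP i j) => [ij|ji|/val_inj <-].
- have <- : corner_value i l j = B i (stair l j).
    by rewrite /corner_value; case: (nat_of_ord j) ij.
  by apply/factor_exchange/stair_exchange; rewrite neq_ltn ij orbT.
- by rewrite mulr1.
- by rewrite !mul1r.
Qed.

End Factors.

(** * Spectra and genericity *)

Section Spectra.
Variables (F : fieldType) (m : nat).

Lemma unitmx_spectrum (A : 'M[F]_m) : ~ spectrum A 0 -> A \in unitmx.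
Proof.
rewrite -row_free_unit -kermx_eq0 => /negP; rewrite /eigenvalue /eigenspace.
by rewrite raddf0 subr0 negbK.
Qed.

Lemma spectrum_diag (d : 'I_m -> F) :
  spectrum (diag_mx (\row_j d j)) = range d.
Proof.
apply/seteqP; split=> x /=.
  move=> /eigenvalueP[v vd /rV0Pn[j vj]]; exists j => //.
  have /rowP/(_ j) := vd; rewrite mul_mx_diag !mxE mulrC.
  exact: mulIf.
move=> [j _ <-]; apply/eigenvalueP; exists (delta_mx 0 j).
  apply/rowP => k; rewrite mul_mx_diag !mxE eqxx /=.
  by have [->|_] := eqVneq k j; rewrite ?mulr1 ?mul1r ?mulr0 ?mul0r.
by apply/rV0Pn; exists j; rewrite mxE !eqxx oner_neq0.
Qed.

Lemma zariski_open_in_self n (V : set ('I_n -> 'M[F]_m)) : zariski_open_in V V.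
Proof.
exists setT; apply/seteqP; split=> [B VB|B []//]; split=> //.
by exists (mpoly.mpolyC _ 1) => //; rewrite mpoly.mevalC oner_neq0.
Qed.

End Spectra.

Theorem proposition4p4 (R : realType) (m n M : nat)
    (hm : (1 <= m)%N) (hn : (1 <= n)%N) (hM : (0 < M)%N)
    (a : 'I_n -> 'I_m -> R[i])
    (ha : forall i j i' j', (i, j) <> (i', j') ->
            forall t : int, a i j - a i' j' <> t%:~R)
    (A0 : 'M[R[i]]_m) (rho : 'I_m -> R[i])
    (hA0 : spectrum A0 = range rho)
    (hrho0 : forall i, rho i <> 0)
    (hrho : forall i j, i <> j -> rho i / rho j \isn't Num.real) :
  generic_in (prescribed_spectra a) [set B0 : 'I_n -> 'M[R[i]]_m |
    forall B : matrix_family R[i] n m,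
      schlesinger_solution M A0 B0 B ->
      (forall i l,
         (forall j, Cdefined M j l /\ Cdefined M j (l + unitv i)) ->
         C_exchange A0 (Cfam B) i l) /\
      (forall i l,
         Cdefined M i l -> Cdefined M i (l + ones n) ->
         Cfam B i (l + ones n) =
           invmx A0 *m Cfam B i l *m A0 - 1%:M)].
Proof.
have A0_unit : A0 \in unitmx.
  by apply: unitmx_spectrum; rewrite hA0 /= => -[i _ /hrho0].
exists (prescribed_spectra a); split; first exact: zariski_open_in_self.
  by exists (fun i => diag_mx (\row_j a i j)) => i; apply: spectrum_diag.
move=> B0 _ B [BP _ _]; split=> i l; last first.
  rewrite /Cfam shift_after_ones => l_in l1_in.
  by apply: (schlesinger_shift BP); rewrite // -shift_after_ones.
move=> l_in; apply: (stair_C_exchange hM A0_unit BP) => j.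
by have [l_j li_j] := l_in j; rewrite -shift_after_stair.
Qed.
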